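(* Let $\mathbb{X}\subset\mathbb{R}^n$ be compact with $\mathbf{0}$ an interior point of $\mathbb{X}$. Suppose $\mathbf{f}\in\mathcal{C}(\mathbb{X};\mathbb{R}^d)$, $\mathbf{f}(\mathbf{0})=\mathbf{0}$, and $\mathbf{f}$ is continuously differentiable in a neighborhood of $\mathbf{0}$. Then for all $\varepsilon>0$, there exists a feedforward neural network with bounded, non-constant, $\mathcal{C}^1$ activation functions, $\mathcal{N}\in\mathcal{C}^1(\mathbb{X};\mathbb{R}^{d\times n})$, such that for all $\mathbf{x}\in\mathbb{X}$, $$\left\|\mathbf{f}(\mathbf{x})-\left[\frac{\partial\mathbf{f}}{\partial\mathbf{x}}(\mathbf{0})+\mathcal{N}(\mathbf{x})-\mathcal{N}(\mathbf{0})\right]\mathbf{x}\right\|_1<\varepsilon.$$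
   Context: $\mathcal{C}(\mathbb{X};\mathbb{R}^d)$ is the space of continuous functions $\mathbb{X}\to\mathbb{R}^d$, and $\mathcal{C}^1(\mathbb{X};\mathbb{R}^{d\times n})$ the space of continuously differentiable functions with values in real $d\times n$ matrices; $\|\cdot\|_1$ is the $\ell^1$ norm on $\mathbb{R}^d$; $\partial\mathbf{f}/\partial\mathbf{x}$ denotes the Jacobian matrix. A feedforward neural network is a function on $\mathbb{R}^n$ (restricted to $\mathbb{X}$) given by a finite composition of layers, each hidden layer being an affine map followed by a scalar activation function $\mathbb{R}\to\mathbb{R}$ applied componentwise, with at least one hidden layer, and the output layer being affine; here the output in $\mathbb{R}^{dn}$ is identified with a $d\times n$ matrix. *)

(* Defs.v *)
From HB Require Import structures.
From mathcomp Require Import all_boot all_order all_algebra.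
From mathcomp Require Import all_classical all_reals all_analysis.

Set Implicit Arguments.
Unset Strict Implicit.
Unset Printing Implicit Defensive.
Import Order.TTheory GRing.Theory Num.Theory.
Import numFieldNormedType.Exports.
Local Open Scope classical_set_scope.
Local Open Scope ring_scope.

Section calculus.
Variable R : realType.

Definition l1norm d (v : 'cV[R]_d) : R := \sum_(i < d) `|v i 0|.

Definition partial n (V : normedModType R) (j : 'I_n) (f : 'cV[R]_n -> V)
  (x : 'cV[R]_n) : V := 'D_(delta_mx j 0) f x.

(* The library's [jacobian] is for functions between row vectors and acts on
   the right; this is the usual d x n matrix acting on column vectors. *)
Definition jacobian_mx n d (f : 'cV[R]_n -> 'cV[R]_d) (x : 'cV[R]_n) :
  'M[R]_(d, n) := \matrix_(i < d, j < n) partial j f x i 0.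

Lemma diff_jacobian_mx n d (f : 'cV[R]_n -> 'cV[R]_d) (x v : 'cV[R]_n) :
  differentiable f x -> 'd f x v = jacobian_mx f x *m v.
Proof.
move=> df; rewrite {1}(matrix_sum_delta v) linear_sum /=.
apply/matrixP => i k; rewrite ord1 mxE summxE; apply: eq_bigr => j _.
by rewrite big_ord1 linearZ /= !mxE /partial deriveE // mulrC.
Qed.

(* [f] is continuously differentiable on a neighborhood of the set [A] (of the
   point [a] when [A] is [set a]). *)
Definition C1_near n (V : normedModType R) (A : set 'cV[R]_n)
    (f : 'cV[R]_n -> V) : Prop :=
  exists U : set 'cV[R]_n, [/\ open U, A `<=` U &
    forall x, U x -> differentiable f x /\
                     forall j, {for x, continuous (partial j f)}].

Definition C1_real (s : R -> R) : Prop :=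
  (forall x, derivable s x 1) /\ continuous (derive1 s).

Definition nonconstant (s : R -> R) : Prop := exists x y, s x != s y.

End calculus.

(* Feedforward networks from R^n to R^p with at least one hidden layer; the
   hidden layers have positive widths, and each has its own activation. *)
Inductive fnn (R : realType) (p n : nat) : Type :=
| LastHidden k (W : 'M[R]_(k.+1, n)) (b : 'cV[R]_k.+1) (s : R -> R)
    (W' : 'M[R]_(p, k.+1)) (b' : 'cV[R]_p)
| Hidden k (W : 'M[R]_(k.+1, n)) (b : 'cV[R]_k.+1) (s : R -> R)
    (N : fnn R p k.+1).

Fixpoint fnn_eval (R : realType) p n (N : fnn R p n) :
    'cV[R]_n -> 'cV[R]_p :=
  match N with
  | LastHidden _ W b s W' b' => fun x => W' *m map_mx s (W *m x + b) + b'
  | Hidden _ W b s N' => fun x => fnn_eval N' (map_mx s (W *m x + b))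
  end.

Fixpoint all_activations (R : realType) (P : (R -> R) -> Prop) p n
    (N : fnn R p n) : Prop :=
  match N with
  | LastHidden _ _ _ s _ _ => P s
  | Hidden _ _ _ s N' => P s /\ all_activations P N'
  end.

(* The output in R^(d * n), read as a d x n matrix in row-major order. *)
Definition fnn_mx (R : realType) d n (N : fnn R (d * n) n) (x : 'cV[R]_n) :
  'M[R]_(d, n) := vec_mx (fnn_eval N x)^T.

(* Main.v *)
From HB Require Import structures.
Require Import Defs.
From mathcomp Require Import all_boot all_order all_algebra.
From mathcomp Require Import all_classical all_reals all_analysis.
From mathcomp Require Import ring lra.
Import Order.TTheory GRing.Theory Num.Theory.
Import numFieldNormedType.Exports.
Local Open Scope classical_set_scope.
Local Open Scope ring_scope.

(** The theorem reduces to uniform approximation of a single continuous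
    matrix-valued function on [X].  Let [r x = f x - J x], where [J] is the
    Jacobian of [f] at [0].  Differentiability of [f] at [0] says that
    [r x = o(|x|)], so the matrix [g x = |x|_2^-2 r(x) x^T], extended by
    [g 0 = 0], is continuous on [X] even at [0]; and [g x *m x = r x] by
    construction.  If [N] is within [e] of [g] on [X], entry by entry, then
    the residual of the theorem is [((g x - N x) - (g 0 - N 0)) *m x], whose
    entries are at most [2 n e] times a bound on the norm over [X].

    For the approximation, the activation can be taken to be the cosine, and
    one hidden layer is enough.  Networks of this kind compute the sums of
    terms [cos (w x + b) c].  The real-valued ones contain the constants,
    are closed under products because
    [cos a cos b = (cos (a + b) + cos (a - b)) / 2], and separate points; so
    they are dense by the Stone-Weierstrass theorem, proved first as
    [stone_weierstrass].  Matrix-valued functions are approximated entry by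
    entry ([trig_density]).  The partial derivatives of such a sum are again
    such sums, because [- sin t = cos (t + pi / 2)], and this makes them
    continuously differentiable ([trig_sum_C1]). *)

(** * The Stone-Weierstrass theorem *)

(** A property that holds locally for some index in [L] holds on all of a
    compact [X] for one index, provided that any two indices have a common
    improvement.  The sets whose complement in [X] is handled by a single
    index form a filter; if no index handled [X] this filter would be proper,
    and an index that works near one of its cluster points is a
    contradiction.  It replaces the extraction of a finite subcover, both for
    the maxima and for the minima of the Stone-Weierstrass theorem. *)
Lemma compact_directed (T : topologicalType) (X : set T) (G : Type)
    (L : set G) (P : G -> T -> Prop) :
  compact X -> (exists g, L g) ->
  (forall g1 g2, L g1 -> L g2 ->
     exists2 g, L g & forall x, X x -> P g1 x \/ P g2 x -> P g x) ->
  (forall y, X y -> exists2 g, L g & \forall x \near y, X x -> P g x) ->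
  exists2 g, L g & forall x, X x -> P g x.
Proof.
move=> cptX [g0 Lg0] join loc; apply: contrapT => noG.
pose F : set_system T :=
  [set S | exists2 g, L g & forall x, X x -> ~ S x -> P g x].
have FF : ProperFilter F.
  split; first by move=> [g Lg Pg]; apply: noG; exists g => // x Xx; exact: Pg.
  split.
  - by exists g0 => // x _ [].
  - move=> S1 S2 [g1 Lg1 P1] [g2 Lg2 P2].
    have [g Lg Pg] := join _ _ Lg1 Lg2.
    exists g => // x Xx /not_andP[nS|nS]; apply: Pg => //.
    + by left; apply: P1.
    + by right; apply: P2.
  - move=> S1 S2 S12 [g Lg Pg]; exists g => // x Xx nS2.
    by apply: Pg => // /S12.
have FX : F X by exists g0.
have [y [Xy Fy]] := cptX F FF FX.
have [g Lg Pg] := loc y Xy.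
have FS : F [set x | X x /\ ~ P g x].
  by exists g => // x Xx /not_andP[//|/contrapT].
by have [x [[Xx nPx] /(_ Xx)]] := Fy _ _ FS Pg.
Qed.

(** Polynomials in [t] that increase to [|t|] on [[-1, 1]]: Newton-like steps
    for the square root of [t ^ 2], with a division by 2 in place of
    the division by twice the current value. *)
Fixpoint abs_iter (R : realType) (k : nat) (t : R) : R :=
  if k is k'.+1 then
    abs_iter R k' t + 2^-1 * (t * t - abs_iter R k' t * abs_iter R k' t)
  else 0.

(** The error [e = |t| - q] is multiplied at each step by
    [1 - (|t| + q) / 2 <= 1 - |t| / 2], and
    [(2 + (k + 1) |t|) (1 - |t| / 2) <= 2 + k |t|], so the quantity
    [(2 + k |t|) e] cannot grow. *)
Lemma abs_iter_bound (R : realType) (t : R) (k : nat) : `|t| <= 1 ->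
  [/\ 0 <= abs_iter R k t, abs_iter R k t <= `|t| &
      (2 + k%:R * `|t|) * (`|t| - abs_iter R k t) <= 2 * `|t|].
Proof.
move=> t1; have t0 := normr_ge0 t.
elim: k => [|k [q0 qt IH]] /=.
  by split => //; rewrite mul0r addr0 subr0.
have tt : t * t = `|t| * `|t| by rewrite -normrM ger0_norm// -expr2 sqr_ge0.
rewrite tt; set a := `|t| in t1 t0 qt IH *.
set q := abs_iter R k t in q0 qt IH *.
have k0 : 0 <= k%:R :> R by exact: ler0n.
(* The factor by which one step shrinks the error. *)
have E : a - (q + 2^-1 * (a * a - q * q)) = (a - q) * (1 - (a + q) / 2).
  by field.
split.
- have : 0 <= (a - q) * (a + q) by apply: mulr_ge0; lra.
  lra.
- rewrite -subr_ge0 E; apply: mulr_ge0; lra.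
- rewrite E; apply: le_trans IH.
  rewrite -subr_ge0.
  have -> : (2 + k%:R * a) * (a - q) -
     (2 + k.+1%:R * a) * ((a - q) * (1 - (a + q) / 2)) =
     (a - q) * (q + (k%:R + 1) * a * (a + q) / 2).
    by rewrite -natr1; field.
  apply: mulr_ge0; first lra.
  apply: addr_ge0 => //; apply: divr_ge0 => //.
  by apply: mulr_ge0; [apply: mulr_ge0|]; lra.
Qed.

Lemma abs_iter_cvg (R : realType) (t : R) (k : nat) : `|t| <= 1 ->
  `| `|t| - abs_iter R k.+1 t| <= 2 / k.+1%:R.
Proof.
move=> t1; have [q0 qt H] := abs_iter_bound R t k.+1 t1.
set q := abs_iter R k.+1 t in q0 qt H *; have t0 := normr_ge0 t.
rewrite ger0_norm ?subr_ge0// ler_pdivlMr ?ltr0n//.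
have k0 : 0 < k.+1%:R :> R by rewrite ltr0n.
have [a0|a0] := ltrP 0 `|t|; last first.
  by have -> : `|t| - q = 0; [lra|rewrite mul0r].
rewrite -(ler_pM2r a0); apply: le_trans H.
have -> : (2 + k.+1%:R * `|t|) * (`|t| - q) =
  (`|t| - q) * k.+1%:R * `|t| + 2 * (`|t| - q) by ring.
by rewrite lerDl mulr_ge0// subr_ge0.
Qed.

(** [A] is a point-separating algebra of functions that are continuous on the
    compact set [X].  Its uniform closure on [X] is shown to be a lattice, and
    then to contain every continuous function. *)
Section StoneWeierstrass.
Variables (R : realType) (T : topologicalType) (X : set T).
Variable A : set (T -> R).
Hypothesis cptX : compact X.
Hypothesis A_cst : forall c, A (cst c).
Hypothesis A_add : forall f g, A f -> A g -> A (f \+ g).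
Hypothesis A_mul : forall f g, A f -> A g -> A (f \* g).
Hypothesis A_cont : forall f, A f -> {within X, continuous f}.
Hypothesis A_sep :
  forall x y, X x -> X y -> x <> y -> exists2 f, A f & f x != f y.

Definition uniform_closure : set (T -> R) :=
  [set h | forall e, 0 < e ->
     exists2 g, A g & forall x, X x -> `|h x - g x| < e].

Let B := uniform_closure.

Let A_scale c f : A f -> A (fun x => c * f x).
Proof. by move=> Af; apply: (A_mul _ _ (A_cst c) Af). Qed.

Let A_lin c f g : A f -> A g -> A (fun x => f x + c * g x).
Proof. by move=> Af Ag; apply: (A_add _ _ Af (A_scale c _ Ag)). Qed.

Lemma near_within_continuous (f : T -> R) y e : {within X, continuous f} ->
  X y -> 0 < e -> \forall x \near y, X x -> `|f y - f x| < e.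
Proof.
move=> /subspace_continuousP/(_ y) + Xy e0 => /(_ Xy)/cvgrPdist_lt/(_ e e0).
by rewrite near_withinE.
Qed.

Lemma uniform_closure_id f : A f -> B f.
Proof. by move=> Af e e0; exists f => // x _; rewrite subrr normr0. Qed.

Lemma uniform_closure_lin c f g : B f -> B g -> B (fun x => f x + c * g x).
Proof.
move=> Bf Bg e e0.
have c1 : 0 < 1 + `|c| by have := normr_ge0 c; lra.
have e1 : 0 < e / (1 + `|c|) by rewrite divr_gt0.
have [f' Af' Hf] := Bf _ e1; have [g' Ag' Hg] := Bg _ e1.
exists (fun x => f' x + c * g' x); first exact: A_lin.
move=> x Xx.
have -> : f x + c * g x - (f' x + c * g' x) = (f x - f' x) + c * (g x - g' x).
  by ring.
apply: le_lt_trans (ler_normD _ _) _; rewrite normrM.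
have -> : e = e / (1 + `|c|) + `|c| * (e / (1 + `|c|)).
  by field; rewrite gt_eqF.
by rewrite ltr_leD ?Hf// ler_wpM2l// ltW// Hg.
Qed.

Lemma subalgebra_bounded f : A f ->
  exists2 M, 0 < M & forall x, X x -> `|f x| <= M.
Proof.
move=> /A_cont cf.
apply: (compact_directed T X R [set M | 0 < M] (fun M x => `|f x| <= M)) => //.
- by exists 1; rewrite /= ltr01.
- move=> M1 M2 /= M10 M20; exists (M1 + M2); first exact: addr_gt0.
  by move=> x _ []; lra.
- move=> y Xy; exists (1 + `|f y|); first by rewrite /= ltr_wpDr.
  have := near_within_continuous _ _ _ cf Xy ltr01; apply: filterS => x H /H.
  rewrite distrC => /ltW H1; rewrite -lerBlDr.
  exact: le_trans (lerB_dist _ _) H1.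
Qed.

Lemma uniform_closure_closed f :
  (forall e, 0 < e -> exists2 g, B g & forall x, X x -> `|f x - g x| < e) ->
  B f.
Proof.
move=> H e e0; have e2 : 0 < e / 2 by rewrite divr_gt0.
have [g /(_ _ e2)[h Ah gh] fg] := H _ e2.
exists h => // x Xx; rewrite [e]splitr.
by apply: le_lt_trans (ler_distD (g x) _ _) _; rewrite ltrD ?fg ?gh.
Qed.

(** After division by a bound [M] of [|f|] on [X], the values lie in [[-1, 1]],
    where the polynomials [abs_iter] approximate the absolute value, and [A]
    is closed under polynomials. *)
Lemma subalgebra_abs f : A f -> B (fun x => `|f x|).
Proof.
move=> Af e e0; have [M M0 fM] := subalgebra_bounded f Af.
pose k := Num.trunc (2 * M / e).
have kP : 2 * M / e < k.+1%:R by rewrite truncnS_gt.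
exists (fun x => M * abs_iter R k.+1 (M^-1 * f x)).
  apply: A_scale; elim: (k.+1) => [|m IH] /=; first exact: A_cst.
  have Ag := A_scale M^-1 _ Af.
  apply: (A_lin 2^-1 _ _ IH).
  have := A_lin (-1) _ _ (A_mul _ _ Ag Ag) (A_mul _ _ IH IH).
  by congr A; apply/funext => x /=; ring.
move=> x Xx.
have fMx : `|M^-1 * f x| <= 1.
  by rewrite normrM normfV (gtr0_norm M0) mulrC ler_pdivrMr// mul1r fM.
have -> : `|f x| = M * `|M^-1 * f x|.
  by rewrite normrM normfV (gtr0_norm M0) mulVKf// gt_eqF.
rewrite -mulrBr normrM gtr0_norm//.
apply: le_lt_trans (ler_wpM2l (ltW M0) (abs_iter_cvg R _ k fMx)) _.
rewrite mulrCA mulrA ltr_pdivrMr ?ltr0n// [_ * _%:R]mulrC.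
by rewrite -ltr_pdivrMr.
Qed.

Lemma uniform_closure_abs f : B f -> B (fun x => `|f x|).
Proof.
move=> Bf; apply: uniform_closure_closed => e e0; have [g Ag fg] := Bf _ e0.
exists (fun x => `|g x|); first exact: subalgebra_abs.
by move=> x Xx; apply: le_lt_trans (ler_dist_dist _ _) (fg x Xx).
Qed.

Lemma uniform_closure_max f g : B f -> B g -> B (f \max g).
Proof.
move=> Bf Bg.
have -> : f \max g = fun x =>
    cst 0 x + 2^-1 * ((f x + 1 * g x) + 1 * `|f x + -1 * g x|).
  apply/funext => x; rewrite [LHS]maxr_absE !mul1r mulN1r mulrC.
  by rewrite [RHS]add0r.
apply: uniform_closure_lin; first exact/uniform_closure_id.
apply: uniform_closure_lin; first exact: uniform_closure_lin.
exact/uniform_closure_abs/uniform_closure_lin.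
Qed.

Lemma uniform_closure_min f g : B f -> B g -> B (f \min g).
Proof.
move=> Bf Bg.
have -> : f \min g = fun x => (f x + 1 * g x) + -1 * (f \max g) x.
  by apply/funext => x; rewrite mul1r mulN1r -(addr_max_min (f x)) addrC addKr.
apply: uniform_closure_lin; first exact: uniform_closure_lin.
exact: uniform_closure_max.
Qed.

Lemma subalgebra_interpolation x y a b : X x -> X y -> (x = y -> a = b) ->
  exists2 g, A g & g x = a /\ g y = b.
Proof.
move=> Xx Xy ab; have [xy|xy] := pselect (x = y).
  by exists (cst a) => //; rewrite -ab.
have [h Ah hxy] := A_sep _ _ Xx Xy xy.
have d0 : h y - h x != 0 by rewrite subr_eq0 eq_sym.
exists (fun z => a - (b - a) / (h y - h x) * h x + (b - a) / (h y - h x) * h z).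
  exact: (A_lin _ _ _ (A_cst _) Ah).
by split; field.
Qed.

(** For each [x], a maximum of functions interpolating [f] at [x] and at
    another point exceeds [f - e / 3] everywhere and is still below
    [f + e / 3] at [x]; a minimum of such maxima over [x] is then also below
    [f + e] everywhere. *)
Theorem stone_weierstrass f : {within X, continuous f} -> uniform_closure f.
Proof.
move=> cf; apply: uniform_closure_closed => e e0.
have [->|/set0P[x0 Xx0]] := eqVneq X set0.
  by exists (cst 0) => //; exact/uniform_closure_id.
pose e3 := e / 3; have e30 : 0 < e3 by rewrite divr_gt0.
have above x : X x ->
  exists2 h, B h /\ h x < f x + e3 & forall y, X y -> f y - e3 < h y.
  move=> Xx.
  apply: (compact_directed T X _ [set h | B h /\ h x < f x + e3]
           (fun h y => f y - e3 < h y)) => //.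
  - exists (cst (f x)); split; first exact/uniform_closure_id.
    by rewrite /= ltrDl.
  - move=> h1 h2 [Bh1 h1x] [Bh2 h2x]; exists (h1 \max h2).
      by split; [exact: uniform_closure_max|rewrite /= gt_max h1x].
    by move=> y Xy []; rewrite /= lt_max => ->; rewrite ?orbT.
  - move=> y Xy.
    have [|g Ag [gx gy]] := subalgebra_interpolation x y (f x) (f y) Xx Xy.
      by move=> ->.
    exists g; first by split; [exact: uniform_closure_id|rewrite gx ltrDl].
    have eh : 0 < e3 / 2 by rewrite divr_gt0.
    near=> z => Xz.
    have : X z -> `|f y - f z| < e3 / 2.
      by near: z; exact: near_within_continuous.
    have : X z -> `|g y - g z| < e3 / 2.
      by near: z; apply: near_within_continuous => //; exact: A_cont.
    by move=> /(_ Xz)/ltr_normlP[? ?] /(_ Xz)/ltr_normlP[? ?]; lra.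
have [h [Bh hlo] hhi] : exists2 h, B h /\ (forall y, X y -> f y - e3 < h y) &
    forall x, X x -> h x < f x + e.
  apply: (compact_directed T X _
    [set h | B h /\ (forall y, X y -> f y - e3 < h y)]
    (fun h x => h x < f x + e)) => //.
  - by have [h [Bh _] hlo] := above x0 Xx0; exists h.
  - move=> h1 h2 [Bh1 h1y] [Bh2 h2y]; exists (h1 \min h2).
      split; first exact: uniform_closure_min.
      by move=> y Xy; rewrite /= lt_min h1y// h2y.
    by move=> y Xy []; rewrite /= gt_min => ->; rewrite ?orbT.
  - move=> y Xy; have [h [Bh hy] hlo] := above y Xy; exists h => //.
    have eh : 0 < e3 / 3 by rewrite divr_gt0.
    (* [h] need not be continuous as given, so the bound at [y] spreads to a
       neighborhood through a continuous approximation [g] of [h]. *)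
    have [g Ag hg] := Bh _ eh.
    near=> z => Xz.
    have : X z -> `|f y - f z| < e3 / 3.
      by near: z; exact: near_within_continuous.
    have : X z -> `|g y - g z| < e3 / 3.
      by near: z; apply: near_within_continuous => //; exact: A_cont.
    have /ltr_normlP[? ?] := hg _ Xy; have /ltr_normlP[? ?] := hg _ Xz.
    move=> /(_ Xz)/ltr_normlP[? ?] /(_ Xz)/ltr_normlP[? ?].
    have : e = 3 * e3 by rewrite /e3; field.
    lra.
exists h => // x Xx; have := hlo x Xx; have := hhi x Xx => ? ?.
have : e = 3 * e3 by rewrite /e3; field.
by move=> ?; apply/ltr_normlP; split; lra.
Unshelve. all: by end_near. Qed.
End StoneWeierstrass.

(** * Sums of cosines of affine forms *)

(** An entry [(c, (w, b))] of the list stands for the term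
    [cos (w x + b) c]. *)
Definition trig_sum (R : realType) (V : lmodType R) (n : nat)
    (s : seq (V * ('rV[R]_n * R))) (x : 'cV[R]_n) : V :=
  \sum_(t <- s) cos ((t.2.1 *m x) 0 0 + t.2.2) *: t.1.

Section TrigSum.
Variables (R : realType) (n : nat).

Lemma is_diff_linear_form (w : 'rV[R]_n) (x : 'cV[R]_n) :
  is_diff x (fun y : 'cV[R]_n => (w *m y) 0 0) (fun v => (w *m v) 0 0).
Proof.
pose phi (y : 'cV[R]_n) : R := (w *m y) 0 0.
have lin_phi : linear phi by move=> a u v; rewrite /phi linearP !mxE.
pose phiM := GRing.isLinear.Build _ _ _ _ _ lin_phi.
pose phiL : {linear _ -> _} := HB.pack phi phiM.
have dphi y : differentiable phi y.
  have -> : phi = \sum_(j < n) w 0 j *: (fun z : 'cV[R]_n => z j 0 : R).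
    by apply/funext => z; rewrite fct_sumE /phi mxE.
  by apply: differentiable_sum => j; apply/differentiableZ/differentiable_coord.
apply: DiffDef; first exact: dphi.
rewrite -[fun _ => _]/(phiL : _ -> _) diff_lin// => y.
exact/differentiable_continuous/dphi.
Qed.

Lemma is_diff_cos (u : R) : is_diff u (@cos R) (fun h => h * - sin u).
Proof.
have du : derivable (@cos R) u 1 by exact: derivable_cos.
apply: DiffDef; first exact/derivable1_diffP.
by rewrite deriv1E// derive1E derive_val.
Qed.

Lemma is_diff_cos_phase (w : 'rV[R]_n) (b : R) (x : 'cV[R]_n) :
  is_diff x (fun y : 'cV[R]_n => cos ((w *m y) 0 0 + b))
   (fun v => (w *m v) 0 0 * - sin ((w *m x) 0 0 + b)).
Proof.
have dphase : is_diff x (fun y : 'cV[R]_n => (w *m y) 0 0 + b)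
                        (fun v => (w *m v) 0 0).
  have := is_diffD (is_diff_linear_form w x) (is_diff_cst b x).
  by rewrite addr0.
exact: is_diff_comp dphase (is_diff_cos _).
Qed.

Lemma trig_sum_nil (V : lmodType R) : trig_sum R V n [::] = cst 0.
Proof. by apply/funext => y; rewrite /trig_sum big_nil. Qed.

Lemma trig_sum_cons (V : lmodType R) c w b s :
  trig_sum R V n ((c, (w, b)) :: s) =
  (fun y => cos ((w *m y) 0 0 + b) *: c) + trig_sum R V n s.
Proof. by apply/funext => y; rewrite /trig_sum big_cons. Qed.

(** A derivative of a sum of cosines is a sum of cosines with shifted phases,
    which spares a separate study of the continuity of the derivatives. *)
Lemma trig_sum_diff (V : normedModType R) (s : seq (V * ('rV[R]_n * R))) x :
  differentiable (trig_sum R V n s) x /\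
  forall v : 'cV[R]_n, 'd (trig_sum R V n s) x v = trig_sum R V n
    [seq ((t.2.1 *m v) 0 0 *: t.1, (t.2.1, t.2.2 + pi / 2)) | t <- s] x.
Proof.
elim: s => [|[c [w b]] s [IHd IH]].
  rewrite trig_sum_nil; split; first exact: differentiable_cst.
  by move=> v; rewrite diff_cst.
have [dw dwE] := is_diff_cos_phase w b x.
rewrite trig_sum_cons; split.
  by apply: differentiableD => //; exact: differentiableZl.
move=> v; rewrite diffD//; last exact: differentiableZl.
rewrite /= trig_sum_cons -[RHS]/(_ + trig_sum _ _ _ _ _) -IH /=.
congr +%R; rewrite diffZl// dwE /=.
by rewrite addrA cosDpihalf scalerA mulrC.
Qed.

Definition trig_functions (V : lmodType R) : set ('cV[R]_n -> V) :=
  range (trig_sum R V n).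

Lemma trig_functionsD (V : lmodType R) f g : trig_functions V f ->
  trig_functions V g -> trig_functions V (fun x => f x + g x).
Proof.
move=> [s _ <-] [t _ <-]; exists (s ++ t) => //.
by apply/funext => x; rewrite /trig_sum big_cat.
Qed.

Lemma trig_functions_sum (V : lmodType R) (I : finType)
    (f : I -> 'cV[R]_n -> V) :
  (forall i, trig_functions V (f i)) ->
  trig_functions V (fun x => \sum_i f i x).
Proof.
move=> tf; rewrite -[fun x => _]fct_sumE; elim/big_rec: _ => [|i g _ tg].
  by exists [::] => //; apply/funext => x; rewrite /trig_sum big_nil.
exact: trig_functionsD.
Qed.

Lemma trig_functions_scale (V : lmodType R) (v : V) f :
  trig_functions R^o f -> trig_functions V (fun x => f x *: v).
Proof.
move=> [s _ <-]; exists [seq (t.1 *: v, t.2) | t <- s] => //.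
apply/funext => x; rewrite /trig_sum big_map scaler_suml.
by apply: eq_bigr => t _; rewrite scalerA.
Qed.

Lemma trig_functions_cst (c : R) : trig_functions R^o (cst c).
Proof.
exists [:: (c, (0, 0))] => //; apply/funext => x.
by rewrite /trig_sum big_seq1 mul0mx mxE addr0 cos0 scale1r.
Qed.

(** The product-to-sum formula: each pair of terms contributes one term with
    the sum and one with the difference of the two phases. *)
Lemma trig_functionsM (f g : 'cV[R]_n -> R) : trig_functions R^o f ->
  trig_functions R^o g -> trig_functions R^o (f \* g).
Proof.
move=> [s _ <-] [t _ <-].
pose term (p : R -> R -> R) (q : 'rV[R]_n -> 'rV[R]_n -> 'rV[R]_n)
  (a b : R^o * ('rV[R]_n * R)) : R^o * ('rV[R]_n * R) :=
  (a.1 * b.1 / 2, (q a.2.1 b.2.1, p a.2.2 b.2.2)).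
exists ([seq term +%R +%R a b | a <- s, b <- t] ++
   [seq term (fun x y => x - y) (fun x y => x - y) a b | a <- s, b <- t]) => //.
apply/funext => x; rewrite /trig_sum big_cat !big_allpairs_dep /= -big_split /=.
rewrite big_distrlr; apply: eq_bigr => a _.
rewrite -big_split; apply: eq_bigr => b _ /=.
rewrite mulmxBl mulmxDl !mxE addrACA cosD.
have -> (u v w z : R) : u - v + (w - z) = (u + w) - (v + z) by ring.
by rewrite cosB -![_ *: _]/(_ * _); field.
Qed.

(** In a coordinate [j] that distinguishes [x] from [y], the phase
    [a (z_j - y_j)] is [0] at [y], and [a] is chosen to make it [pi / 2]
    at [x]. *)
Lemma trig_functions_separate (x y : 'cV[R]_n) : x <> y ->
  exists2 f, trig_functions R^o f & f x != f y.
Proof.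
move=> xy; have [j xyj] : exists j, x j 0 != y j 0.
  apply: contrapT => /forallNP H; apply: xy; apply/matrixP => i k.
  by rewrite ord1; have /negP/negPn/eqP := H i.
have d0 : x j 0 - y j 0 != 0 by rewrite subr_eq0.
pose a := pi / 2 / (x j 0 - y j 0).
have E z : ((a *: delta_mx 0 j : 'rV_n) *m z) 0 0 = a * z j 0.
  by rewrite -scalemxAl mxE -rowE mxE.
exists (trig_sum R R^o n [:: (1, (a *: delta_mx 0 j, - (a * y j 0)))]).
  by exists [:: (1, (a *: delta_mx 0 j, - (a * y j 0)))].
rewrite /trig_sum !big_seq1 /= !E subrr cos0 -mulrBr mulfVK// cos_pihalf.
by rewrite scale0r scale1r eq_sym oner_eq0.
Qed.

Lemma trig_density d m (X : set 'cV[R]_n) (g : 'cV[R]_n -> 'M[R]_(d, m))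
    (e : R) :
  compact X -> (forall i j, {within X, continuous (fun x => g x i j)}) ->
  0 < e ->
  exists s, forall x i j, X x ->
    `|g x i j - trig_sum R 'M[R]_(d, m) n s x i j| < e.
Proof.
move=> cptX cg e0.
have H (p : 'I_d * 'I_m) : exists f, trig_functions R^o f /\
    forall x, X x -> `|g x p.1 p.2 - f x| < e.
  have := stone_weierstrass R _ X (trig_functions R^o) cptX trig_functions_cst
    (trig_functionsD R^o) trig_functionsM.
  case/(_ _ _ _ (cg p.1 p.2) _ e0).
  - move=> f [s _ <-]; apply: continuous_subspaceT => x.
    exact/differentiable_continuous/(trig_sum_diff R^o s x).1.
  - by move=> x y _ _; exact: trig_functions_separate.
  - by move=> f tf gf; exists f.
have [h hP] := choice H.
have [s _ sE] := trig_functions_sum 'M[R]_(d, m) _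
  (fun p x => h p x *: delta_mx p.1 p.2)
  (fun p => trig_functions_scale 'M[R]_(d, m) (delta_mx p.1 p.2) _ (hP p).1).
exists s => x i j Xx; rewrite sE.
have -> : \sum_p h p x *: delta_mx p.1 p.2 = \matrix_(k, l) h (k, l) x.
  rewrite [RHS]matrix_sum_delta pair_bigA; apply: eq_bigr => -[k l] _.
  by rewrite mxE.
by rewrite mxE; exact: (hP (i, j)).2.
Qed.

(** * Networks with cosine activation *)

(** There is one hidden unit per term of the sum and a last one, which reads
    the default value of [nth]: its output weights vanish, and it keeps the
    layer nonempty when the sum is. *)
Definition trig_network p (s : seq ('cV[R]_p * ('rV[R]_n * R))) : fnn R p n :=
  @LastHidden R p n (size s)
    (\matrix_(i, j) (nth 0 s i).2.1 0 j) (\col_i (nth 0 s i).2.2)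
    (@cos R) (\matrix_(a, i) (nth 0 s i).1 a 0) 0.

Lemma trig_networkE p s x :
  fnn_eval (trig_network p s) x = trig_sum R 'cV[R]_p n s x.
Proof.
rewrite /= addr0; apply/matrixP => a k; rewrite ord1 mxE big_ord_recr /=.
rewrite [X in _ + X * _]mxE nth_default// mxE mul0r addr0.
rewrite /trig_sum (big_nth 0) big_mkord summxE; apply: eq_bigr => i _.
rewrite !mxE mulrC; congr (cos (_ + _) * _).
by apply: eq_bigr => j _; rewrite !mxE.
Qed.

Lemma trig_sum_C1 (V : normedModType R) (s : seq (V * ('rV[R]_n * R))) X :
  C1_near X (trig_sum R V n s).
Proof.
exists setT; split=> //; first exact: openT.
move=> x _; split; first exact: (trig_sum_diff V s x).1.
move=> j; have -> : partial j (trig_sum R V n s) = trig_sum R V n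
   [seq ((t.2.1 *m (delta_mx j 0 : 'cV[R]_n)) 0 0 *: t.1,
         (t.2.1, t.2.2 + pi / 2)) | t <- s].
  apply/funext => y; have [ds dsE] := trig_sum_diff V s y.
  by rewrite -dsE /partial deriveE.
exact/differentiable_continuous/(trig_sum_diff V _ x).1.
Qed.

Lemma cos_activation :
  [/\ bounded_fun (@cos R), nonconstant (@cos R) & C1_real (@cos R)].
Proof.
split.
- exists 1; split => // M M1 x _ /=; exact: le_trans (cos_max x) (ltW M1).
- by exists 0, pi; rewrite cos0 cospi gt_eqF//; lra.
- split=> [x|]; first exact: derivable_cos.
  have -> : derive1 (@cos R) = fun x => - sin x.
    by apply/funext => x; rewrite derive1E derive_val.
  by move=> x; apply: continuousN; exact: continuous_sin.
Qed.

End TrigSum.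

Lemma trig_network_mx (R : realType) n d
    (s : seq ('M[R]_(d, n) * ('rV[R]_n * R))) :
  exists N : fnn R (d * n) n,
   [/\ all_activations
         (fun s => [/\ bounded_fun s, nonconstant s & C1_real s]) N &
       fnn_mx N = trig_sum R 'M[R]_(d, n) n s].
Proof.
exists (trig_network R n _ [seq ((mxvec t.1)^T, t.2) | t <- s]); split.
  exact: cos_activation.
apply/funext => x; rewrite /fnn_mx trig_networkE /trig_sum big_map.
rewrite !linear_sum; apply: eq_bigr => t _.
by rewrite !linearZ /= trmxK mxvecK.
Qed.

(** * Division of a remainder by its argument *)

Section RadialQuotient.
Variables (R : realType) (n d : nat).
Implicit Type x : 'cV[R]_n.

Definition sqnorm x : R := (x^T *m x) 0 0.

Lemma sqnormE x : sqnorm x = \sum_j x j 0 * x j 0.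
Proof. by rewrite /sqnorm mxE; apply: eq_bigr => j _; rewrite mxE. Qed.

Lemma le_entry_norm p q (M : 'M[R]_(p, q)) i j : `|M i j| <= `|M|.
Proof.
by rewrite [leRHS]/Num.Def.normr /= mx_normrE; apply: (le_bigmax _ _ (i, j)).
Qed.

Lemma le_norm_sqnorm x : `|x| * `|x| <= sqnorm x.
Proof.
rewrite sqnormE; have [->|/mx_norm_neq0[[j k] /= xjk]] := eqVneq `|x| 0.
  by rewrite mul0r sumr_ge0// => j _; rewrite -expr2 sqr_ge0.
rewrite -[`|x|]/(mx_norm x) xjk ord1 -normrM ger0_norm -?expr2 ?sqr_ge0//.
by rewrite (bigD1 j)//= -expr2 lerDl sumr_ge0// => l _; rewrite -expr2 sqr_ge0.
Qed.

Lemma sqnorm_eq0 x : (sqnorm x == 0) = (x == 0).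
Proof.
apply/eqP/eqP => [q0|->]; last by rewrite /sqnorm mulmx0 mxE.
apply/eqP; rewrite -normr_eq0 -[_ == 0]orbb -mulf_eq0 eq_le mulr_ge0//.
by rewrite andbT -q0 le_norm_sqnorm.
Qed.

Lemma sqnorm_continuous : continuous sqnorm.
Proof.
move=> x; apply: differentiable_continuous.
have -> : sqnorm = \sum_(j < n) (fun y : 'cV[R]_n => y j 0 : R) *
                                (fun y : 'cV[R]_n => y j 0 : R).
  by apply/funext => y; rewrite fct_sumE sqnormE.
apply: differentiable_sum => j.
by apply: differentiableM; exact: differentiable_coord.
Qed.

(** For nonzero [x], among the matrices that send [x] to [r x], this is the
    one that vanishes on the orthogonal complement of [x]. *)
Definition radial_quotient (r : 'cV[R]_n -> 'cV[R]_d) x : 'M[R]_(d, n) :=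
  (sqnorm x)^-1 *: (r x *m x^T).

Lemma radial_quotient0 r : radial_quotient r 0 = 0.
Proof. by rewrite /radial_quotient trmx0 mulmx0 scaler0. Qed.

Lemma radial_quotientK r x : r 0 = 0 -> radial_quotient r x *m x = r x.
Proof.
move=> r0; have [->|x0] := eqVneq x 0; first by rewrite mulmx0 r0.
rewrite -scalemxAl -mulmxA [x^T *m x]mx11_scalar mul_mx_scalar scalerA.
by rewrite mulVf ?scale1r// sqnorm_eq0.
Qed.

(** At [0], the entries are bounded by [|r x| |x| / |x|_2^2], hence by
    [|r x| / |x|] as the sup norm is at most the Euclidean norm; the
    hypothesis that [r] is [o(|x|)] makes this small. *)
Lemma radial_quotient_continuous (X : set 'cV[R]_n) r i j :
  {within X, continuous r} ->
  (forall e, 0 < e -> \forall x \near (0 : 'cV[R]_n), `|r x| <= e * `|x|) ->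
  {within X, continuous (fun x => radial_quotient r x i j)}.
Proof.
move=> cr r_o; apply/subspace_continuousP => x Xx.
have gE y : radial_quotient r y i j = (sqnorm y)^-1 * (r y i 0 * y j 0).
  by rewrite !mxE big_ord1 mxE.
(* Strips the coercion that marks functions on a subspace. *)
suff : radial_quotient r y i j @[y --> within X (nbhs x)] -->
       (radial_quotient r x i j : R) by [].
have [x0|x0] := eqVneq x 0.
  rewrite x0 radial_quotient0 mxE; apply/cvgrPdist_le => e e0.
  rewrite near_withinE; near=> y => Xy; rewrite sub0r normrN.
  have [->|y0] := eqVneq y 0; first by rewrite radial_quotient0 mxE normr0 ltW.
  rewrite gE.
  have y_gt0 : 0 < `|y| by rewrite normr_gt0.
  have q_gt0 : 0 < sqnorm y.
    by apply: lt_le_trans (le_norm_sqnorm y); rewrite mulr_gt0.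
  rewrite normrM normfV (gtr0_norm q_gt0) mulrC ler_pdivrMr// normrM.
  apply: le_trans (ler_wpM2l (ltW e0) (le_norm_sqnorm y)).
  rewrite mulrA ler_pM ?le_entry_norm//.
  have ry : `|r y| <= e * `|y| by near: y; exact: r_o.
  exact: le_trans (le_entry_norm _ _ _ _ _) ry.
rewrite (funext gE) gE; apply: cvgM.
  apply: cvgV; first by rewrite sqnorm_eq0.
  exact: (@cvg_within_filter _ _ _ _ _ _ X (sqnorm_continuous x)).
apply: cvgM.
  have /subspace_continuousP/(_ x Xx) cri := cr.
  exact: (continuous_cvg _ (@coord_continuous _ _ _ i 0 (r x)) cri).
exact: (@cvg_within_filter _ _ _ _ _ _ X (@coord_continuous _ _ _ j 0 x)).
Unshelve. all: by end_near. Qed.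

Lemma l1norm_mulmx_le (M : 'M[R]_(d, n)) x (B e : R) :
  (forall i j, `|M i j| <= e) -> `|x| <= B ->
  l1norm (M *m x) <= d%:R * n%:R * (e * B).
Proof.
move=> Me xB; rewrite -mulrA.
have row i : `|(M *m x) i 0| <= n%:R * (e * B).
  rewrite mxE; apply: le_trans (ler_norm_sum _ _ _) _.
  rewrite mulr_natl -[X in _ *+ X]card_ord -sumr_const.
  apply: ler_sum => j _; rewrite normrM ler_pM//.
  exact: le_trans (le_entry_norm _ _ _ _ _) xB.
rewrite /l1norm mulr_natl -[X in _ *+ X]card_ord -sumr_const.
by apply: ler_sum => i _; exact: row.
Qed.

End RadialQuotient.

(** * Approximation of [f] by the network *)

Theorem theorem2 (R : realType) (n d : nat) (X : set 'cV[R]_n)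
    (f : 'cV[R]_n -> 'cV[R]_d) :
  compact X -> interior X 0 ->
  {within X, continuous f} -> f 0 = 0 -> C1_near [set 0] f ->
  forall eps : R, 0 < eps ->
  exists N : fnn R (d * n) n,
    [/\ all_activations
          (fun s => [/\ bounded_fun s, nonconstant s & C1_real s]) N,
        C1_near X (fnn_mx N) &
        forall x, X x ->
          l1norm (f x - (jacobian_mx f 0 + fnn_mx N x - fnn_mx N 0) *m x)
            < eps].
Proof.
move=> cptX X0 cf f0 [U [_ U0 C1f]] eps eps0.
have df : differentiable f 0 by have [] := C1f 0 (U0 0 erefl).
pose r x := f x - jacobian_mx f 0 *m x.
have r0 : r 0 = 0 by rewrite /r f0 mulmx0 subrr.
have rE x : r x = f x - 'd f 0 x by rewrite /r -diff_jacobian_mx.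
have cr : {within X, continuous r}.
  apply/subspace_continuousP => x Xx; rewrite (funext rE); apply: cvgB.
    by move/subspace_continuousP : cf; exact.
  have cd : continuous ('d f 0) by exact: diff_continuous.
  exact: (@cvg_within_filter _ _ _ _ _ _ X (cd x)).
have r_o e : 0 < e -> \forall x \near (0 : 'cV[R]_n), `|r x| <= e * `|x|.
  move=> e0; have /diff_locally/eqaddoP/(_ e e0) := df; apply: filterS => x.
  by rewrite rE !fctE /= addr0 f0 add0r.
have [B B0 XB] : exists2 B : R, 0 < B & forall x, X x -> `|x| <= B.
  have [B [_ BX]] := compact_bounded cptX.
  exists (`|B| + 1); first by rewrite ltr_wpDl.
  by move=> x Xx; apply: BX => //; rewrite (le_lt_trans (ler_norm B))// ltrDl.
(* Adding 1 keeps [C] positive when [d] or [n] is 0. *)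
pose C : R := d%:R * n%:R * B + 1.
have C0 : 0 < C by rewrite ltr_wpDl// !mulr_ge0// ltW.
(* Half of [eps / C], because [N] is compared with [g] both at [x] and
   at [0]. *)
have e0 : 0 < eps / C / 2 by rewrite !divr_gt0.
have [s sP] := trig_density R n d n X (radial_quotient R n d r) _ cptX
  (fun i j => radial_quotient_continuous R n d X r i j cr r_o) e0.
have [N [actN NE]] := trig_network_mx R n d s.
exists N; split => //; first by rewrite NE; exact: trig_sum_C1.
move=> x Xx; rewrite NE.
set g := radial_quotient R n d r in sP; set h := trig_sum _ _ _ _ in sP *.
have -> : f x - (jacobian_mx f 0 + h x - h 0) *m x =
    ((g x - h x) - (g 0 - h 0)) *m x.
  rewrite [g 0]radial_quotient0 sub0r opprK !mulmxDl.
  rewrite (radial_quotientK _ _ _ _ _ r0).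
  by rewrite !mulNmx /r !opprD !opprK !addrA.
have near_g y i j : X y -> `|(g y - h y) i j| <= eps / C / 2.
  by move=> Xy; rewrite mxE [X in _ + X]mxE ltW// sP.
have near_g0 i j : `|((g x - h x) - (g 0 - h 0)) i j| <= eps / C.
  rewrite mxE [X in _ + X]mxE; apply: le_trans (ler_normB _ _) _.
  by rewrite [eps / C]splitr lerD// near_g//; exact: interior_subset X0.
apply: le_lt_trans (l1norm_mulmx_le _ _ _ _ _ _ _ near_g0 (XB _ Xx)) _.
have -> : d%:R * n%:R * (eps / C * B) = eps * ((C - 1) / C).
  by rewrite /C; field; rewrite gt_eqF.
by rewrite gtr_pMr// ltr_pdivrMr// mul1r ltrBlDr ltrDl.
Qed.
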